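(* Consider the single-batch change model described in the context, and suppose that for every batch $e\in\{1,\dots,E\}$ the post-change parameter set $\Lambda^{e}=\{\lambda:|\lambda-\theta^{(e)}|\ge\epsilon\}$ is a finite set (where $\epsilon>0$ is fixed). Then the stopping time $\tau_o=\min_{1\le e\le E}\tau^e$ is asymptotically efficient for this change point problem. That is, there exist thresholds $A=A_\beta$ with $A_\beta=\log\beta\,(1+o(1))$ such that, as $\beta\to\infty$, the stopping time $\tau_o$ with threshold $A_\beta$ satisfies \[ \mathbb{E}_\infty[\tau_o]\ge \beta(1+o(1)), \] and there is a constant $C>0$ such that \[ \mathbb{E}_1[\tau_o]\le C\log\beta\,(1+o(1)), \] whenever the change occurs in a single batch $e$ with post-change parameter $\lambda\in\Lambda^e$.
   Context: Let $\{p(\cdot;\theta):\theta\in\Theta\subseteq\mathbb{R}\}$ be a parametric family of probability densities with respect to a common dominating measure. Assume that for any two distinct parameters the Kullback–Leibler divergence between the corresponding densities is finite and strictly positive. **Period and batches.** Fix a period $T\in\mathbb{N}$ and integers $0=N_0<N_1<\dots<N_E=T$. The batches are $B_e=\{N_{e-1}+1,\dots,N_e\}$ for $e=1,\dots,E$, which partition $\{1,\dots,T\}$. For $k\in\mathbb{N}$, the batch of $k$, written $b(k)$, is the unique $j$ with $r(k)\in B_j$. Here $r(k)\in\{1,\dots,T\}$ is the residue of $k$ modulo $T$, with residue $0$ identified with $T$. There are baseline (pre-change) parameters $\theta^{(1)},\dots,\theta^{(E)}$. **Pre-change model.** Under the no-change measure $\mathbb{P}_\infty$, the observations $Y_1,Y_2,\dots$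 are independent with $Y_k\sim p(\cdot;\theta^{(b(k))})$. This is an independent and periodically identically distributed process with a step-wise constant parameter within each batch. **Single-batch change model.** For a change time $\gamma\in\mathbb{N}$, an unknown affected batch $e$, and a post-change parameter $\lambda\ne\theta^{(e)}$, the measure $\mathbb{P}_\gamma$ makes the $Y_k$ independent with the following laws: - $Y_k\sim p(\cdot;\theta^{(b(k))})$ if $k<\gamma$, or if $k\ge\gamma$ and $b(k)\ne e$; - $Y_k\sim p(\cdot;\lambda)$ if $k\ge\gamma$ and $b(k)=e$. $\mathbb{E}_\gamma$ denotes expectation under $\mathbb{P}_\gamma$. **Statistics and stopping rule.** For $\epsilon>0$ let $\Lambda^e=\{\lambda:|\lambda-\theta^{(e)}|\ge\epsilon\}$. Define \[ W_n^e=\max_{1\le k\le n}\ \sup_{\lambda\in\Lambda^e}\ \sum_{i=k,\ b(i)=e}^{n}\log\frac{p(Y_i;\lambda)}{p(Y_i;\theta^{(e)})}, \] where an empty sum equals $0$. Define $\tau^e=\inf\{n\ge1:W_n^e>A\}$ for a threshold $A>0$, and $\tau_o=\min_{1\le e\le E}\tau^e$. **Asymptotic efficiency.** A family of stopping times $\tau$ indexed by a false-alarm parameter $\beta$ is called asymptotically efficient if, as $\beta\to\infty$, $\mathbb{E}_\infty[\tau]\ge\beta(1+o(1))$, and there exists a constant $C>0$ with $\mathbb{E}_1[\tau]\le C\log\beta\,(1+o(1))$. *)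

(* Defs.v *)
From HB Require Import structures.
From mathcomp Require Import all_boot all_order all_algebra.
From mathcomp Require Import all_classical all_reals all_analysis.
Set Implicit Arguments. Unset Strict Implicit. Unset Printing Implicit Defensive.
Import Order.TTheory GRing.Theory Num.Theory.
Import numFieldNormedType.Exports.
Local Open Scope classical_set_scope.
Local Open Scope ring_scope.

Section Defs.
Context {R : realType}.

Definition elog (x : R) : \bar R := if 0 < x then (ln x)%:E else -oo%E.

(** Kullback–Leibler divergence KL(p(.;t) || p(.;t')) is finite and strictly
    positive: absolute continuity (p(.;t') > 0 mu-a.e. where p(.;t) > 0),
    integrability of p log(p/p') on {p(.;t) > 0}, and positive integral. *)
Definition KL_finite_pos {dT} {T : measurableType dT}
  (mu : {measure set T -> \bar R}) (p : R -> T -> R) (t t' : R) : Prop :=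
  let S := [set y | 0 < p t y] in
  {ae mu, forall y, 0 < p t y -> 0 < p t' y} /\
  mu.-integrable S (fun y => (p t y * ln (p t y / p t' y))%:E) /\
  (0 < \int[mu]_(y in S) (p t y * ln (p t y / p t' y))%:E)%E.

End Defs.

(** residue r(k) of k modulo per, with residue 0 identified with per *)
Definition resid (per k : nat) : nat := ((k.-1) %% per).+1.

Definition in_batch (per E : nat) (N : nat -> nat) (k j : nat) : bool :=
  [&& 1 <= j <= E & N j.-1 < resid per k <= N j]%N.

Section Model.
Context {R : realType} {dT : measure_display} {T : measurableType dT}.

Definition Lambda (Theta : set R) (theta : nat -> R) (eps : R) (e : nat) : set R :=
  [set l | Theta l /\ eps <= `|l - theta e|].

Definition indep_obs {dO} {O : measurableType dO} (P : probability O R)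
  (Y : nat -> O -> T) : Prop :=
  forall (s : seq nat) (A : nat -> set T), uniq s -> all (fun i => 0 < i)%N s ->
    (forall i, measurable (A i)) ->
    P (\bigcap_(i in [set` s]) (Y i @^-1` A i)) =
    (\big[*%E/1%E]_(i <- s) P (Y i @^-1` A i))%E.

Definition obs_model (mu : {measure set T -> \bar R}) (p : R -> T -> R)
  (per E : nat) (N : nat -> nat)
  {dO} {O : measurableType dO} (P : probability O R) (Y : nat -> O -> T)
  (par : nat -> nat -> R) : Prop :=
  (forall k, (0 < k)%N -> measurable_fun setT (Y k)) /\
  indep_obs P Y /\
  (forall k j, (0 < k)%N -> in_batch per E N k j ->
     forall A, measurable A ->
       P (Y k @^-1` A) = (\int[mu]_(y in A) (p (par k j) y)%:E)%E).

(** log-likelihood ratio log p(y;l)/p(y;t) (extended: -oo when p(y;l) = 0) *)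
Definition llr (p : R -> T -> R) (l t : R) (y : T) : \bar R := elog (p l y / p t y).

Definition Wstat (p : R -> T -> R) (per E : nat) (N : nat -> nat)
  (Theta : set R) (theta : nat -> R) (eps : R) (e : nat)
  {O : Type} (Y : nat -> O -> T) (n : nat) (w : O) : \bar R :=
  \big[Order.max/-oo%E]_(1 <= k < n.+1)
    ereal_sup [set (\sum_(k <= i < n.+1 | in_batch per E N i e)
                      llr p l (theta e) (Y i w))%E
              | l in Lambda Theta theta eps e].

Definition tau_e (p : R -> T -> R) (per E : nat) (N : nat -> nat)
  (Theta : set R) (theta : nat -> R) (eps : R) (A : R) (e : nat)
  {O : Type} (Y : nat -> O -> T) (w : O) : \bar R :=
  ereal_inf [set (n%:R)%:E | n in
     [set n | (0 < n)%N /\ (A%:E < Wstat p per E N Theta theta eps e Y n w)%E]].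

Definition tau_o (p : R -> T -> R) (per E : nat) (N : nat -> nat)
  (Theta : set R) (theta : nat -> R) (eps : R) (A : R)
  {O : Type} (Y : nat -> O -> T) (w : O) : \bar R :=
  \big[Order.min/+oo%E]_(1 <= e < E.+1)
     tau_e p per E N Theta theta eps A e Y w.

End Model.

(* Main.v *)
Require Import Defs.
From HB Require Import structures.
From mathcomp Require Import all_boot all_order all_algebra.
From mathcomp Require Import all_classical all_reals all_analysis.
From mathcomp Require Import measurable_realfun lra ring zify.
Import Order.TTheory GRing.Theory Num.Theory.
Import numFieldNormedType.Exports.
Local Open Scope classical_set_scope.
Local Open Scope ring_scope.
Set Implicit Arguments.
Unset Strict Implicit.

(** The null expectation is controlled by Ville's maximal inequality. Under the
    no-change law a likelihood ratio product started at any time [k] is a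
    nonnegative supermartingale of mean at most [1], so it ever exceeds [e^A]
    with probability at most [e^-A]. A union bound over the finitely many pairs
    (batch, parameter) and the start times [k < m] gives
    [P(tau_o < m) <= m K e^-A], with [K] the number of pairs; taking
    [e^A = 8 (K + 1) b] and [m] between [2 b] and [3 b] makes the mean at least
    [b].

    For the delay, let [rho] be the Hellinger affinity of the pre- and
    post-change densities, which is [< 1] because the divergence is positive.
    Under the post-change law the inverse square root of each likelihood ratio
    has mean [rho], so Markov's inequality shows that the product over [m]
    periods is at most [e^A] with probability at most [e^(A/2) rho^m]. Summing
    over [m] bounds the mean by a multiple of [A] plus a constant. *)

(** * Integrals of nonnegative functions: monotonicity and change of density *)

Section integral_extra.
Context {R : realType}.
Local Open Scope ereal_scope.
Import HBNNSimple.

(* The integral of a nonnegative function is a supremum over the simple functions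
   below it, hence it is monotone even on non-measurable functions. *)
Lemma ge0_le_integral_nomeas d (X : measurableType d)
    (mu : {measure set X -> \bar R}) (f g : X -> \bar R) :
  (forall x, 0 <= f x) -> (forall x, f x <= g x) ->
  \int[mu]_x f x <= \int[mu]_x g x.
Proof.
move=> f0 fg; rewrite !ge0_integralTE//; last first.
  by move=> x; exact: le_trans (f0 x) (fg x).
apply: ereal_sup_le => _ [h /= hf <-]; exists h => //= x.
exact: le_trans (hf x) (fg x).
Qed.

(** For simple [f] this is linearity, each level set being evaluated by the hypothesis on [nu];
    monotone convergence does the rest. One statement covers laws with a density ([phi] the
    identity) and images of a weighted [P]. *)
Lemma ge0_integral_density d1 d2 (X : measurableType d1) (Y : measurableType d2)
    (phi : X -> Y) (mu : {measure set X -> \bar R})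
    (nu : {measure set Y -> \bar R}) (g : X -> R) (f : Y -> \bar R) :
  measurable_fun setT phi -> measurable_fun setT g -> (forall x, (0 <= g x)%R) ->
  (forall A, measurable A -> nu A = \int[mu]_(x in phi @^-1` A) (g x)%:E) ->
  measurable_fun setT f -> (forall y, 0 <= f y) ->
  \int[nu]_y f y = \int[mu]_x (f (phi x) * (g x)%:E).
Proof.
move=> mphi mg g0 nuE mf f0; pose f_ := nnsfun_approx measurableT mf.
have mpre A : measurable A -> measurable (phi @^-1` A).
  by move=> mA; rewrite -[X in measurable X]setTI; exact: mphi.
have mfphi n : measurable_fun setT (fun x => (f_ n (phi x))%:E).
  by apply/measurable_EFinP; apply: (measurableT_comp (f := f_ n)).
have mEg : measurable_fun setT (fun x => (g x)%:E) by exact/measurable_EFinP.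
transitivity (limn (fun n => \int[nu]_y (f_ n y)%:E)).
  rewrite -monotone_convergence//=.
  - apply: eq_integral => x _; apply/esym/cvg_lim => //.
    exact: cvg_nnsfun_approx.
  - by move=> n; exact/measurable_EFinP.
  - by move=> n x _; rewrite lee_fin.
  - by move=> x _ a b ab; rewrite lee_fin//; exact/lefP/nd_nnsfun_approx.
transitivity (limn (fun n => \int[mu]_x ((f_ n (phi x))%:E * (g x)%:E)));
  last first.
  rewrite -monotone_convergence//=.
  - apply: eq_integral => x _; apply/cvg_lim => //.
    by apply: cvgeZr => //; exact: cvg_nnsfun_approx.
  - by move=> n; exact: emeasurable_funM.
  - by move=> n x _; rewrite -EFinM lee_fin mulr_ge0.
  - move=> x _ a b ab; rewrite lee_pmul// ?lee_fin//.
    exact/lefP/nd_nnsfun_approx.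
congr (limn _); apply/funext => n.
under eq_integral do rewrite fimfunE -fsumEFin//.
rewrite ge0_integral_fsum//; last 2 first.
  - by move=> r; exact/measurable_EFinP/measurableT_comp.
  - by move=> r x _; rewrite EFinM nnfun_muleindic_ge0.
have mpr r : measurable (phi @^-1` (f_ n @^-1` [set r])) by exact: mpre.
transitivity (\int[mu]_x (\sum_(r \in range (f_ n))
   (r * \1_(phi @^-1` (f_ n @^-1` [set r])) x)%:E * (g x)%:E)); last first.
  apply: eq_integral => x _.
  rewrite fimfunE -fsumEFin// ge0_mule_fsuml//.
  by move=> r; rewrite EFinM nnfun_muleindic_ge0.
have nn r x : 0 <= (r * \1_(phi @^-1` (f_ n @^-1` [set r])) x)%:E.
  by have := nnfun_muleindic_ge0 (f_ n) r (phi x); rewrite -EFinM.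
rewrite ge0_integral_fsum//; last 2 first.
  - move=> r; apply: emeasurable_funM => //; apply/measurable_EFinP.
    exact/measurable_funM.
  - by move=> r x _; rewrite mule_ge0// lee_fin.
apply: eq_fsbigr => r /set_mem[y _ fyr].
rewrite integralZl_indic_nnsfun//= integral_indic// setIT nuE//.
under [RHS]eq_integral do rewrite EFinM -muleA.
rewrite ge0_integralZl//; last 3 first.
  - by apply: emeasurable_funM => //; apply/measurable_EFinP.
  - by move=> x _; rewrite mule_ge0// lee_fin.
  - by rewrite lee_fin -fyr.
congr (_ * _); rewrite [LHS]integral_mkcond; apply: eq_integral => x _.
by rewrite patchE indicE; case: ifP => _; rewrite ?mul1e ?mul0e.
Qed.

End integral_extra.

(** * Independence of the next observation from the past *)

Section independence.
Context {R : realType} {dT dO : measure_display} {T : measurableType dT}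
  {O : measurableType dO} (P : probability O R) (Y : nat -> O -> T).
Hypothesis mY : forall k, (0 < k)%N -> measurable_fun setT (Y k).
Hypothesis indepY : indep_obs P Y.
Local Open Scope ereal_scope.

(** These rectangles form a pi-system, which is what uniqueness of measures asks of a generator. *)
Definition past_rect (n : nat) : set (set O) :=
  [set A | exists F : nat -> set T, (forall i, measurable (F i)) /\
     A = \bigcap_(i in [set` iota 1 n]) (Y i @^-1` F i)].

(* [O] with the sigma-algebra generated by [Y 1, ..., Y n]. *)
Definition past (n : nat) := g_sigma_algebraType (past_rect n).

Let measurable_preY k (B : set T) : (0 < k)%N -> measurable B ->
  measurable (Y k @^-1` B).
Proof. by move=> k0 mB; rewrite -[X in measurable X]setTI; exact: mY. Qed.

Lemma measurable_past_rect n : past_rect n `<=` measurable.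
Proof.
move=> _ [F [mF ->]]; rewrite bigcap_seq big_seq.
apply: big_ind => //; first exact: measurableI.
by move=> i; rewrite mem_iota => /andP[i0 _]; exact: measurable_preY.
Qed.

Lemma past_rect_setI n : setI_closed (past_rect n).
Proof.
move=> _ _ [F [mF ->]] [G [mG ->]]; exists (fun i => F i `&` G i); split.
  by move=> i; exact: measurableI.
by rewrite -bigcapI; apply: eq_bigcapr => i _; rewrite preimage_setI.
Qed.

Lemma measurable_fun_past n : measurable_fun setT (id : O -> past n).
Proof.
move=> _ A mA; rewrite setTI.
apply: (smallest_sub (@sigma_algebra_measurable _ O) _ mA).
exact: measurable_past_rect.
Qed.

Lemma measurable_obs_past n i : (0 < i <= n)%N ->
  measurable_fun setT (Y i : past n -> T).
Proof.
move=> i0n _ B mB; rewrite setTI; apply: sub_sigma_algebra.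
exists (fun j => if j == i then B else setT); split.
  by move=> j; case: ifP.
apply/seteqP; split => [x Bx j /=|x /(_ i) /=].
  by case: eqP => // ->.
by rewrite eqxx mem_iota; apply; lia.
Qed.

(** For fixed [B], both sides are finite measures of [A]; they agree on the rectangles by
    independence, hence on the sigma-algebra that these generate. *)
Lemma indep_past_event n (A : set O) (B : set T) :
  <<s past_rect n >> A -> measurable B ->
  P (A `&` Y n.+1 @^-1` B) = P A * P (Y n.+1 @^-1` B).
Proof.
move=> sA mB; have mYB := @measurable_preY n.+1 B isT mB.
have c0 : (0 <= fine (P (Y n.+1 @^-1` B)))%R by rewrite fine_ge0.
have cE : (fine (P (Y n.+1 @^-1` B)))%:E = P (Y n.+1 @^-1` B).
  by rewrite fineK// fin_num_measure.
pose m1 := mrestr P mYB.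
pose m2 := mscale (NngNum c0) P.
suff -> : P (A `&` Y n.+1 @^-1` B) = m2 A by rewrite /m2 /mscale/= cE muleC.
rewrite -[LHS]/(m1 A).
apply: (g_sigma_algebra_measure_unique (past_rect n) _ (fun=> setT)) sA => //.
- exact: measurable_past_rect.
- move=> _; exists (fun=> setT); split => //.
  by apply/seteqP; split => // x _ i _.
- by apply/seteqP; split => // x _; exists 0%N.
- exact: past_rect_setI.
- move=> _ [F [mF ->]]; rewrite /= /mrestr /mscale /= cE.
  have neq i : i \in iota 1 n -> (i == n.+1) = false.
    by rewrite mem_iota => ?; apply/negbTE; lia.
  have iota_gt0 : all (fun i => (0 < i)%N) (iota 1 n).
    by apply/allP => i; rewrite mem_iota; lia.
  rewrite (@indepY _ F (iota_uniq _ _) iota_gt0 mF).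
  have := @indepY (n.+1 :: iota 1 n) (fun i => if i == n.+1 then B else F i).
  rewrite big_cons eqxx.
  under eq_big_seq => i ii do rewrite neq//.
  move=> <-; last 3 first.
  + by rewrite /= iota_uniq mem_iota andbT; lia.
  + by [].
  + by move=> i; case: ifP.
  congr (P _); apply/seteqP; split => [x [xF xB] i|x xF].
    by rewrite /= inE => /orP[/eqP ->|ii]; rewrite ?eqxx ?neq//; exact: xF.
  split => [i ii|].
    by have := xF i; rewrite /= inE ii orbT neq//; exact.
  by have := xF n.+1; rewrite /= inE eqxx; exact.
- by move=> _; rewrite /= /mrestr setTI -cE ltry.
Qed.
(** The density formula is used twice: restricted to an event [A] of the past, [Y n.+1] has [P A]
    times its law; therefore [f (Y n.+1)], as a density on the past sigma-algebra, gives a multiple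
    of [P]. Finiteness of the mean makes this multiple a real scaling factor. *)
Lemma integral_indep_past n (X : O -> R) (f : T -> R) :
  measurable_fun setT (X : past n -> R) -> (forall w, (0 <= X w)%R) ->
  measurable_fun setT f -> (forall y, (0 <= f y)%R) ->
  \int[P]_w (f (Y n.+1 w))%:E < +oo ->
  \int[P]_w (X w * f (Y n.+1 w))%:E =
  \int[P]_w (X w)%:E * \int[P]_w (f (Y n.+1 w))%:E.
Proof.
move=> mX X0 mf f0 fY; have mYn := @mY n.+1 isT.
have mfY : measurable_fun setT (fun w => f (Y n.+1 w)) by exact: measurableT_comp.
pose Yn : {mfun O >-> T} := mfun_Sub (mem_set mYn).
pose pid : {mfun O >-> past n} := mfun_Sub (mem_set (@measurable_fun_past n)).
have mEf : measurable_fun setT (fun y => (f y)%:E) by exact/measurable_EFinP.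
have mEX : measurable_fun setT (fun w : past n => (X w)%:E).
  exact/measurable_EFinP.
have Ef0 y : 0 <= (f y)%:E by rewrite lee_fin.
have EX0 w : 0 <= (X w)%:E by rewrite lee_fin.
have fYA (A : set (past n)) : measurable A ->
    \int[P]_(w in A) (f (Y n.+1 w))%:E = P A * \int[P]_w (f (Y n.+1 w))%:E.
  move=> sA; have mA : measurable (A : set O).
    by rewrite -[X in measurable X]setTI; exact: (@measurable_fun_past n).
  have c0 : (0 <= fine (P A))%R by rewrite fine_ge0.
  have cE : (fine (P A))%:E = P A by rewrite fineK// fin_num_measure.
  pose nu := mscale (NngNum c0) (distribution P Yn).
  transitivity (\int[nu]_y (f y)%:E).
    rewrite (@ge0_integral_density _ _ _ _ _ (Y n.+1) P _ (\1_A))//.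
    - rewrite [LHS]integral_mkcond; apply: eq_integral => w _.
      by rewrite patchE indicE; case: ifP => _; rewrite ?mule1 ?mule0.
    - move=> B mB; have mYB := @measurable_preY n.+1 B isT mB.
      rewrite integral_indic//; apply/esym.
      by rewrite [LHS]indep_past_event//= /mscale /= cE.
  by rewrite ge0_integral_mscale//= cE ge0_integral_distribution.
set c := \int[P]_w (f (Y n.+1 w))%:E in fYA fY *.
have c0 : (0 <= fine c)%R by rewrite fine_ge0// integral_ge0.
have cE : (fine c)%:E = c by rewrite fineK// ge0_fin_numE// integral_ge0.
pose nu := mscale (NngNum c0) (distribution P pid).
transitivity (\int[nu]_w (X w)%:E).
  rewrite (@ge0_integral_density _ _ _ _ _ pid P _ (fun w => f (Y n.+1 w)))//.
  by move=> A mA; rewrite [RHS]fYA//= /mscale/= cE muleC.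
by rewrite ge0_integral_mscale//= cE ge0_integral_distribution// muleC.
Qed.


Lemma measurable_past_O n d (U : measurableType d) (X : O -> U) :
  measurable_fun setT (X : past n -> U) -> measurable_fun setT X.
Proof. by move=> mX; exact: measurableT_comp mX (@measurable_fun_past n). Qed.

(** * Products over consecutive observations and their maximal inequality *)

Section product.
Variables (f : nat -> T -> R) (n : nat).
Hypothesis mf : forall i, measurable_fun setT (f i).
Hypothesis f0 : forall i y, (0 <= f i y)%R.

(** Here [n] counts the observations skipped, so a sum in [Wstat] that starts at time [k]
    corresponds to the offset [k.-1]. *)
Definition lprod (j : nat) (w : O) : R :=
  (\prod_(n.+1 <= i < (n + j).+1) f i (Y i w))%R.

Lemma lprod_ge0 j w : (0 <= lprod j w)%R.
Proof. by apply: prodr_ge0 => i _. Qed.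

Lemma lprod0 w : lprod 0 w = 1%R.
Proof. by rewrite /lprod addn0 big_geq. Qed.

Lemma lprodS j w :
  lprod j.+1 w = (lprod j w * f (n + j).+1 (Y (n + j).+1 w))%R.
Proof. by rewrite /lprod addnS big_nat_recr//= ltnS leq_addr. Qed.

Lemma measurable_lprod_past j m : (n + j <= m)%N ->
  measurable_fun setT (lprod j : past m -> R).
Proof.
move=> jm; apply: measurable_prod => i; rewrite mem_index_iota => ij.
apply: (measurableT_comp (mf i)); apply: measurable_obs_past; lia.
Qed.

Lemma measurable_lprod j : measurable_fun setT (lprod j).
Proof. exact: measurable_past_O (@measurable_lprod_past j _ (leqnn _)). Qed.

Lemma integral_lprod_le (r : nat -> R) j : (forall i, (0 <= r i)%R) ->
  (forall i, (0 < i)%N -> \int[P]_w (f i (Y i w))%:E <= (r i)%:E) ->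
  \int[P]_w (lprod j w)%:E <= (\prod_(n.+1 <= i < (n + j).+1) r i)%:E.
Proof.
move=> r0 fr; elim: j => [|j IH].
  under eq_integral do rewrite lprod0.
  by rewrite integral_cst//= probability_setT mul1e addn0 big_geq.
under eq_integral do rewrite lprodS.
rewrite integral_indep_past//; last 3 first.
- exact: measurable_lprod_past.
- exact: lprod_ge0.
- exact: le_lt_trans (fr _ _) (ltry _).
rewrite addnS big_nat_recr ?ltnS ?leq_addr//= EFinM.
apply: lee_pmul => //; last exact: fr.
  by apply: integral_ge0 => w _; rewrite lee_fin lprod_ge0.
by apply: integral_ge0 => w _; rewrite lee_fin.
Qed.

Variable c : R.

(** Recursion on the horizon lets measurability and the maximal inequality go by induction. The
    empty product is not tested, so nothing has crossed at horizon [0], whatever [c] is. *)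
Fixpoint crossed (j : nat) (w : O) : bool :=
  if j is i.+1 then crossed i w || (c < lprod i.+1 w)%R else false.

Lemma crossedS j w : crossed j.+1 w = crossed j w || (c < lprod j.+1 w)%R.
Proof. by []. Qed.

Lemma crossedP j i w : (0 < i <= j)%N -> (c < lprod i w)%R -> crossed j w.
Proof.
elim: j => [|j IH]; first by lia.
rewrite crossedS => /andP[i0]; rewrite leq_eqVlt => /orP[/eqP <-|ij] ci.
  by rewrite ci orbT.
by rewrite IH// i0.
Qed.

Lemma measurable_crossed_past j m : (n + j <= m)%N ->
  measurable_fun setT (crossed j : past m -> bool).
Proof.
elim: j => [_|j IH jm]; first exact: measurable_cst.
apply: (@measurable_or _ (past m) setT (crossed j)); first by apply: IH; lia.
by apply: measurable_fun_ltr => //; exact: measurable_lprod_past.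
Qed.

Lemma measurable_crossed j : measurable [set w | crossed j w].
Proof.
have /measurable_past_O := @measurable_crossed_past j _ (leqnn _).
by move=> /(_ measurableT [set true] Logic.I); rewrite setTI.
Qed.

(* The process that follows the product until it first exceeds [c] and is frozen
   at [c] from then on has mean at most [1]. *)
Lemma ville j : (0 <= c)%R ->
  (forall i, (0 < i)%N -> \int[P]_w (f i (Y i w))%:E <= 1) ->
  c%:E * P [set w | crossed j w] <= 1.
Proof.
move=> c0 f1.
pose b j w : R := if crossed j w then 0%R else lprod j w.
have b0 i w : (0 <= b i w)%R by rewrite /b; case: ifP => // _; exact: lprod_ge0.
have mb i m : (n + i <= m)%N -> measurable_fun setT (b i : past m -> R).
  move=> im; apply: measurable_fun_ifT => //; first exact: measurable_crossed_past.
  exact: measurable_lprod_past.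
have mbO i : measurable_fun setT (b i)
  by exact: measurable_past_O (mb i _ (leqnn _)).
pose a j w : R := (c * \1_[set w | crossed j w] w)%R.
have a0 i w : (0 <= a i w)%R by rewrite mulr_ge0.
have aV i w : a i w = if crossed i w then c else 0%R.
  have -> : a i w = (c * (crossed i w)%:R)%R.
    rewrite /a indicE; congr (_ * (nat_of_bool _)%:R)%R.
    by apply/idP/idP; rewrite inE.
  by case: ifP; rewrite ?mulr1 ?mulr0.
have ma i : measurable_fun setT (a i).
  apply: measurable_funM => //; apply: measurable_indic; exact: measurable_crossed.
have aE i : \int[P]_w (a i w)%:E = c%:E * P [set w | crossed i w].
  under eq_integral do rewrite EFinM.
  rewrite ge0_integralZl//; last first.
    apply/measurable_EFinP; apply: measurable_indic; exact: measurable_crossed.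
  by rewrite integral_indic//= ?setIT//; exact: measurable_crossed.
have key : \int[P]_w (a j w)%:E + \int[P]_w (b j w)%:E <= 1.
  elim: j => [|j IH].
    rewrite aE /= set_false measure0 mule0 add0e.
    under eq_integral do rewrite /b /= lprod0.
    by rewrite integral_cst//= probability_setT mul1e.
  apply: le_trans IH; rewrite -ge0_integralD//=; last 4 first.
  - by move=> w _; rewrite lee_fin.
  - exact/measurable_EFinP.
  - by move=> w _; rewrite lee_fin.
  - exact/measurable_EFinP.
  apply: (@le_trans _ _ (\int[P]_w ((a j w)%:E +
      (b j w * f (n + j).+1 (Y (n + j).+1 w))%:E))).
    apply: ge0_le_integral_nomeas => w.
      by rewrite -EFinD lee_fin addr_ge0.
    (* After a crossing both sides equal [c]. At a first crossing the left side is [c], below the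
       product on the right; with no crossing the new product stands on both sides. *)
    rewrite -!EFinD lee_fin !aV /b crossedS lprodS.
    case: (crossed j w) => /=; first by rewrite mul0r.
    by case: ltP => [/ltW h|_]; rewrite ?addr0 ?add0r.
  rewrite ge0_integralD//=; last 4 first.
  - by move=> w _; rewrite lee_fin.
  - exact/measurable_EFinP.
  - by move=> w _; rewrite lee_fin mulr_ge0.
  - apply/measurable_EFinP/measurable_funM => //.
    by apply: (measurableT_comp (mf _)); exact: mY.
  (* [b j] depends on the past only, so the next factor, of mean at most [1], does not increase its
     mean. *)
  rewrite leeD2l// integral_indep_past//; last 2 first.
  - exact: mb.
  - exact: le_lt_trans (f1 _ _) (ltry _).
  rewrite -[leRHS]mule1 lee_wpmul2l ?f1//.
  by apply: integral_ge0 => w _; rewrite lee_fin.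
rewrite -aE; apply: le_trans key; rewrite leeDl//.
by apply: integral_ge0 => w _; rewrite lee_fin.
Qed.

End product.

End independence.

(** * The Hellinger affinity of two distinct densities *)

Section hellinger.
Context {R : realType} {dT : measure_display} {T : measurableType dT}
  (mu : {measure set T -> \bar R}).
Local Open Scope ereal_scope.

Lemma measurable_sqrt : measurable_fun setT (@Num.sqrt R).
Proof. by apply: continuous_measurable_fun; exact: sqrt_continuous. Qed.

(** The half sum of the densities is [Num.sqrt (p t y * p t' y)] plus [h y], half the squared
    difference of their square roots. An affinity of at least [1] forces [h] to have integral [0],
    so the densities agree almost everywhere and the divergence vanishes, a contradiction. *)
Lemma hellinger_lt1 (p : R -> T -> R) (t t' : R) :
  measurable_fun setT (p t) -> measurable_fun setT (p t') ->
  (forall y, (0 <= p t y)%R) -> (forall y, (0 <= p t' y)%R) ->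
  \int[mu]_y (p t y)%:E = 1 -> \int[mu]_y (p t' y)%:E = 1 ->
  KL_finite_pos mu p t t' ->
  \int[mu]_y (Num.sqrt (p t y * p t' y))%:E < 1.
Proof.
move=> mp mq p0 q0 p1 q1 [_ [iKL KL]].
rewrite ltNge; apply/negP => H1.
pose h y := ((p t y + p t' y) / 2 - Num.sqrt (p t y * p t' y))%R.
have hE y : h y = ((Num.sqrt (p t y) - Num.sqrt (p t' y)) ^+ 2 / 2)%R.
  rewrite /h sqrtrM// -{1}(sqr_sqrtr (p0 y)) -{1}(sqr_sqrtr (q0 y)).
  by field.
have h0 y : (0 <= h y)%R by rewrite hE divr_ge0// sqr_ge0.
have mpq : measurable_fun setT (fun y => Num.sqrt (p t y * p t' y)).
  apply: (measurableT_comp measurable_sqrt); exact: measurable_funM.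
have mh : measurable_fun setT h.
  apply: measurable_funB => //; apply: measurable_funM => //.
  exact: measurable_funD.
have mEp : measurable_fun setT (fun y => (p t y)%:E) by exact/measurable_EFinP.
have mEq : measurable_fun setT (fun y => (p t' y)%:E) by exact/measurable_EFinP.
have mEh : measurable_fun setT (fun y => (h y)%:E) by exact/measurable_EFinP.
have mEpq : measurable_fun setT (fun y => (Num.sqrt (p t y * p t' y))%:E).
  exact/measurable_EFinP.
have Ep0 y : 0 <= (p t y)%:E by rewrite lee_fin.
have Eq0 y : 0 <= (p t' y)%:E by rewrite lee_fin.
have Eh0 y : 0 <= (h y)%:E by rewrite lee_fin.
have Epq0 y : 0 <= (Num.sqrt (p t y * p t' y))%:E by rewrite lee_fin sqrtr_ge0.
have sum1 : \int[mu]_y (Num.sqrt (p t y * p t' y))%:E + \int[mu]_y (h y)%:E = 1.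
  rewrite -ge0_integralD//.
  transitivity (\int[mu]_y ((2^-1)%:E * ((p t y)%:E + (p t' y)%:E))).
    by apply: eq_integral => y _; rewrite -!EFinD -EFinM /h; congr EFin; field.
  rewrite ge0_integralZl//.
    2: exact: emeasurable_funD.
    2: by move=> y _; rewrite adde_ge0.
  rewrite ge0_integralD//.
  by rewrite p1 q1 -EFinD -EFinM; congr EFin; field.
have ih0 : \int[mu]_y (h y)%:E = 0.
  have ihge : 0 <= \int[mu]_y (h y)%:E by apply: integral_ge0 => y _; rewrite lee_fin.
  apply/eqP; rewrite eq_le ihge andbT.
  move: sum1 H1 ihge; case: (\int[mu]_y (Num.sqrt _)%:E) => [a| |]//;
    case: (\int[mu]_y (h y)%:E) => [b| |]//=.
  by rewrite -EFinD => -[] ?; rewrite !lee_fin => ? ?; lra.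
have : ae_eq mu setT (EFin \o h) (cst 0).
  apply/(ae_eq_integral_abs mu measurableT); first exact/measurable_EFinP.
  by rewrite -{}[RHS]ih0; apply: eq_integral => y _; rewrite /= ger0_norm.
move=> hae; move: KL; apply/negP; rewrite -leNgt.
have mS : measurable [set y | (0 < p t y)%R].
  have := measurable_fun_ltr (@measurable_cst _ _ T _ setT (0%R : R)) mp.
  by move=> /(_ measurableT [set true] Logic.I); rewrite setTI.
rewrite (ae_eq_integral (cst 0))//; first by rewrite integral0.
  exact: measurable_int iKL.
apply: filterS hae => y /(_ Logic.I)/= hy py.
have /eqP : h y = 0%R by case: hy.
rewrite hE mulf_eq0 invr_eq0 pnatr_eq0 orbF sqrf_eq0 subr_eq0 => /eqP hs.
have e : p t y = p t' y by rewrite -(sqr_sqrtr (p0 y)) hs sqr_sqrtr.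
by rewrite -e divff ?gt_eqF// ln1 mulr0.
Qed.

End hellinger.

(** * The extended logarithm, and finite minima and maxima *)

Section stopping.
Context {R : realType}.
Local Open Scope ereal_scope.

Lemma elog1 : elog (1 : R) = 0.
Proof. by rewrite /elog ltr01 ln1. Qed.

(** Additivity survives a zero factor: [elog 0] is [-oo], and [elog] never takes the value [+oo]. *)
Lemma elogM (x y : R) : (0 <= x)%R -> (0 <= y)%R ->
  elog (x * y) = elog x + elog y.
Proof.
rewrite !le_eqVlt => /predU1P[<-|x0] /predU1P[<-|y0]; rewrite /elog.
- by rewrite mul0r !ltxx.
- by rewrite mul0r !ltxx.
- by rewrite mulr0 !ltxx addeNy.
- by rewrite x0 y0 mulr_gt0// lnM// EFinD.
Qed.

Lemma sum_elog (I : Type) (s : seq I) (Q : pred I) (F : I -> R) :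
  (forall i, (0 <= F i)%R) ->
  \sum_(i <- s | Q i) elog (F i) = elog (\prod_(i <- s | Q i) F i)%R.
Proof.
move=> F0; elim: s => [|i s IH]; first by rewrite !big_nil elog1.
rewrite !big_cons; case: ifP => // _.
by rewrite IH elogM// prodr_ge0.
Qed.

Lemma lt_elog (A x : R) : (0 <= x)%R -> (A%:E < elog x) = (expR A < x)%R.
Proof.
rewrite le_eqVlt => /predU1P[<-|x0]; rewrite /elog.
  by rewrite ltxx ltNge leNye /= ltNge (ltW (expR_gt0 _)).
by rewrite x0 lte_fin -[in RHS](@lnK _ x) ?posrE// ltr_expR.
Qed.

Lemma bigmin_seq_le (s : seq nat) (F : nat -> \bar R) e : e \in s ->
  \big[Order.min/+oo]_(i <- s) F i <= F e.
Proof.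
elim: s => [//|i s IH]; rewrite inE big_cons ge_min => /orP[/eqP ->|es].
  by rewrite lexx.
by rewrite IH// orbT.
Qed.

Lemma lt_bigmax_seq (s : seq nat) (F : nat -> \bar R) (A : \bar R) :
  (A < \big[Order.max/-oo]_(i <- s) F i) <-> exists2 k, k \in s & A < F k.
Proof.
elim: s => [|i s IH]; rewrite ?big_nil ?big_cons.
  by rewrite ltNge leNye; split => // -[].
rewrite lt_max; split => [/orP[h|/IH[k ks h]]|[k]].
- by exists i => //; rewrite inE eqxx.
- by exists k => //; rewrite inE ks orbT.
- rewrite inE => /orP[/eqP -> ->//|ks h].
  by apply/orP; right; apply/IH; exists k.
Qed.

End stopping.

(** * From the log-likelihood statistic to products of ratios *)

Section statistic.
Context {R : realType} {dT : measure_display} {T : measurableType dT}.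
Variables (Theta : set R) (p : R -> T -> R).
Hypothesis hp_ge0 : forall t y, Theta t -> (0 <= p t y)%R.
Variables (per E : nat) (N : nat -> nat) (theta : nat -> R) (eps : R).
Hypothesis htheta : forall e, (1 <= e <= E)%N -> Theta (theta e).
Context {dO : measure_display} {O : measurableType dO} (Y : nat -> O -> T).

(** The value [1] off the batch turns a sum restricted to batch [e] into a product over all
    consecutive times, of the shape of [lprod]. *)
Definition batch_factor (e : nat) (g : T -> R) (i : nat) (y : T) : R :=
  if in_batch per E N i e then g y else 1.

Definition lratio (e : nat) (l : R) (y : T) : R := p l y / p (theta e) y.

Lemma lratio_ge0 e l y : (1 <= e <= E)%N -> Lambda Theta theta eps e l ->
  0 <= lratio e l y.
Proof. by move=> he [Tl _]; rewrite divr_ge0// hp_ge0//; exact: htheta. Qed.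

Lemma lt_Wstat (A : R) e n w : (1 <= e <= E)%N ->
  (A%:E < Wstat p per E N Theta theta eps e Y n w)%E <->
  exists k l, [/\ (k < n)%N, Lambda Theta theta eps e l &
    expR A < lprod Y (batch_factor e (lratio e l)) k (n - k) w].
Proof.
move=> he.
have key k l : (k <= n)%N -> Lambda Theta theta eps e l ->
    (A%:E < \sum_(k.+1 <= i < n.+1 | in_batch per E N i e)
                      llr p l (theta e) (Y i w))%E =
    (expR A < lprod Y (batch_factor e (lratio e l)) k (n - k) w).
  move=> kn hl; rewrite sum_elog; last by move=> i; exact: lratio_ge0.
  rewrite lt_elog; last by apply: prodr_ge0 => i _; exact: lratio_ge0.
  by rewrite /lprod subnKC// big_mkcond.
split=> [/lt_bigmax_seq[k]|[k [l [kn hl h]]]].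
  rewrite mem_index_iota => kn /ereal_sup_gt[_ [l hl <-]] h.
  exists k.-1, l; case: k kn h => // k kn h; split => //.
  by rewrite -key// ltnW.
apply/lt_bigmax_seq; exists k.+1; first by rewrite mem_index_iota; lia.
apply: lt_le_trans (ereal_sup_ubound _); last by exists l.
by rewrite key// ltnW.
Qed.

Lemma tau_o_le (A : R) e n w : (1 <= e <= E)%N -> (0 < n)%N ->
  (A%:E < Wstat p per E N Theta theta eps e Y n w)%E ->
  (tau_o p per E N Theta theta eps A Y w <= n%:R%:E)%E.
Proof.
move=> he n0 h; apply: (@le_trans _ _ (tau_e p per E N Theta theta eps A e Y w)).
  by apply: bigmin_seq_le; rewrite mem_index_iota; lia.
by apply: ereal_inf_lbound; exists n.
Qed.

Lemma tau_o_ge (A : R) m w :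
  (forall e n, (1 <= e <= E)%N -> (0 < n < m)%N ->
     ~ (A%:E < Wstat p per E N Theta theta eps e Y n w)%E) ->
  (m%:R%:E <= tau_o p per E N Theta theta eps A Y w)%E.
Proof.
move=> H; rewrite /tau_o big_seq; apply: (big_ind (fun x => m%:R%:E <= x)%E).
- exact: leey.
- by move=> x y mx my; rewrite le_min mx my.
- move=> e; rewrite mem_index_iota => he; apply: le_ereal_inf_tmp => _ [n [n0 hn] <-].
  rewrite lee_fin ler_nat leqNgt; apply/negP => nm.
  by apply: (H e n) hn; lia.
Qed.

Lemma tau_o_ge0 (A : R) w : (0 <= tau_o p per E N Theta theta eps A Y w)%E.
Proof. by apply: (@tau_o_ge A 0) => e n _; lia. Qed.

End statistic.

(** * Union bound and lower bound on a mean *)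

Section probability_extra.
Context {R : realType} {dO : measure_display} {O : measurableType dO}
  (P : probability O R).
Local Open Scope ereal_scope.

Lemma probability_bigsetU_le (I : eqType) (s : seq I) (F : I -> set O) (x : R) :
  (forall i, i \in s -> measurable (F i)) ->
  (forall i, i \in s -> P (F i) <= x%:E) ->
  P (\big[setU/set0]_(i <- s) F i) <= ((size s)%:R * x)%:E.
Proof.
elim: s => [_ _|i s IH mF Fx]; first by rewrite big_nil measure0 mul0r.
have mFs j : j \in s -> measurable (F j).
  by move=> js; apply: mF; rewrite inE js orbT.
rewrite big_cons; apply: le_trans (measureU2 _ _ _) _.
- by apply: mF; rewrite inE eqxx.
- by rewrite big_seq; apply: bigsetU_measurable => j; exact: mFs.
- rewrite /= -natr1 mulrDl mul1r EFinD addeC leeD ?Fx ?inE ?eqxx// IH// => j js.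
  by apply: Fx; rewrite inE js orbT.
Qed.

(** A Markov bound: [tau] dominates [m] times the indicator of the complement of [B]. The comparison
    goes through [ge0_le_integral_nomeas], since [tau_o] is not shown to be measurable. *)
Lemma expectation_ge (tau : O -> \bar R) (B : set O) (m x : R) :
  (0 <= m)%R -> measurable B -> P B <= x%:E -> (forall w, 0 <= tau w) ->
  (forall w, ~ B w -> m%:E <= tau w) ->
  (m * (1 - x))%:E <= \int[P]_w tau w.
Proof.
move=> m0 mB PB tau0 tauB.
apply: (@le_trans _ _ (\int[P]_w (m%:E * (\1_(~` B) w)%:E))); last first.
  apply: ge0_le_integral_nomeas => w; first by rewrite -EFinM lee_fin mulr_ge0.
  rewrite indicE in_setC; case: (boolP (w \in B)) => [_|/negP wB] /=.
    by rewrite mule0.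
  by rewrite mule1; apply: tauB => Bw; apply: wB; rewrite inE.
have mCB : measurable (~` B) by exact: measurableC.
apply: (@le_trans _ _ (m%:E * P (~` B))); last first.
  rewrite ge0_integralZl//; last by apply/measurable_EFinP; exact: measurable_indic.
  by rewrite integral_indic// setIT.
rewrite EFinM lee_wpmul2l ?lee_fin// probability_setC// EFinB.
exact: leeB.
Qed.

End probability_extra.

(** * Means of functions of one observation *)

Section law.
Context {R : realType} {dT dO : measure_display} {T : measurableType dT}
  {O : measurableType dO} (mu : {measure set T -> \bar R})
  (P : probability O R).
Local Open Scope ereal_scope.

Lemma integral_law (X : O -> T) (q f : T -> R) :
  measurable_fun setT X -> measurable_fun setT q -> (forall y, (0 <= q y)%R) ->
  (forall A, measurable A -> P (X @^-1` A) = \int[mu]_(y in A) (q y)%:E) ->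
  measurable_fun setT f -> (forall y, (0 <= f y)%R) ->
  \int[P]_w (f (X w))%:E = \int[mu]_y (f y * q y)%:E.
Proof.
move=> mX mq q0 PX mf f0.
pose X' : {mfun O >-> T} := mfun_Sub (mem_set mX).
have mEf : measurable_fun setT (fun y => (f y)%:E) by exact/measurable_EFinP.
have Ef0 y : 0 <= (f y)%:E by rewrite lee_fin.
transitivity (\int[distribution P X']_y (f y)%:E).
  by rewrite ge0_integral_distribution.
by rewrite [LHS](@ge0_integral_density _ _ _ _ _ id mu _ q).
Qed.

(** On nonnegative reals the inverse is the power with exponent [-1], also at [0], where both are
    [0]. *)
Lemma measurable_funV_ge0 (f : T -> R) : measurable_fun setT f ->
  (forall y, (0 <= f y)%R) -> measurable_fun setT (fun y => (f y)^-1%R).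
Proof.
move=> mf f0; have -> : (fun y => (f y)^-1%R) = (fun y => powR (f y) (-1)).
  by apply/funext => y; rewrite powR_inv1.
exact: (measurableT_comp (measurable_powR _)).
Qed.

End law.

(** * Lower bound on the mean of [tau_o] under the null law *)

Section bounds.
Context {R : realType} {dT : measure_display} {T : measurableType dT}
  (mu : {measure set T -> \bar R}) (Theta : set R) (p : R -> T -> R).
Hypothesis hp_meas : forall t, Theta t -> measurable_fun setT (p t).
Hypothesis hp_ge0 : forall t y, Theta t -> 0 <= p t y.
Hypothesis hp_int : forall t, Theta t -> (\int[mu]_y (p t y)%:E = 1)%E.
Variables (per E : nat) (N : nat -> nat) (theta : nat -> R) (eps : R).
Hypothesis htheta : forall e, (1 <= e <= E)%N -> Theta (theta e).
Context {dO : measure_display} {O : measurableType dO}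
  (P : probability O R) (Y : nat -> O -> T).
Local Open Scope ereal_scope.

Lemma measurable_lratio e l : (1 <= e <= E)%N -> Theta l ->
  measurable_fun setT (lratio p theta e l).
Proof.
move=> /htheta he hl; apply: measurable_funM; first exact: hp_meas.
by apply: measurable_funV_ge0; [exact: hp_meas|move=> y; exact: hp_ge0].
Qed.

Lemma measurable_batch_factor e (g : T -> R) i : measurable_fun setT g ->
  measurable_fun setT (batch_factor per E N e g i).
Proof. by move=> mg; rewrite /batch_factor; case: in_batch. Qed.

Lemma batch_factor_ge0 e (g : T -> R) i y : (forall y, (0 <= g y)%R) ->
  (0 <= batch_factor per E N e g i y)%R.
Proof. by move=> g0; rewrite /batch_factor; case: in_batch. Qed.

(** This serves both laws: the likelihood ratio under the null law with [r = 1], and its inverse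
    square root under the changed law with the affinity bound as [r]. *)
Lemma integral_batch_factor_le e (g : T -> R) i (par : nat -> nat -> R) (r : R) :
  obs_model mu p per E N P Y par -> (0 < i)%N ->
  Theta (par i e) -> measurable_fun setT g -> (forall y, (0 <= g y)%R) ->
  \int[mu]_y (g y * p (par i e) y)%:E <= r%:E ->
  \int[P]_w (batch_factor per E N e g i (Y i w))%:E <=
    (if in_batch per E N i e then r else 1)%:E.
Proof.
move=> [mY [_ lawY]] i0 hpar mg g0 hr; rewrite /batch_factor.
case: ifP => hi; last by rewrite integral_cst//= probability_setT mul1e.
rewrite (@integral_law _ _ _ _ _ mu P (Y i) (p (par i e)))//.
- exact: mY.
- exact: hp_meas.
- by move=> y; exact: hp_ge0.
- by move=> A mA; exact: lawY.
Qed.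

(** If no product with offset below [m] and pair in [EL] exceeds [expR A] within its horizon, then
    [tau_o] is at least [m]. Ville's inequality bounds each exception by [expR (- A)], and there are
    [m * size EL] of them. *)
Lemma expectation_null_ge (EL : seq (nat * R)) (A : R) (m : nat) :
  (forall e l, (1 <= e <= E)%N -> Lambda Theta theta eps e l <-> (e, l) \in EL) ->
  (forall e l, (e, l) \in EL -> (1 <= e <= E)%N) ->
  obs_model mu p per E N P Y (fun k j => theta j) ->
  (m%:R * (1 - (m * size EL)%:R * expR (- A)))%:E <=
    \int[P]_w tau_o p per E N Theta theta eps A Y w.
Proof.
move=> hEL hEL1 hobs; have [mY [indepY _]] := hobs.
pose s := [seq (k, el) | k <- iota 0 m, el <- EL].
pose F (x : nat * (nat * R)) := [set w |
  crossed Y (batch_factor per E N x.2.1 (lratio p theta x.2.1 x.2.2)) x.1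
    (expR A) m w].
have sP x : x \in s -> (1 <= x.2.1 <= E)%N /\ Lambda Theta theta eps x.2.1 x.2.2.
  move=> /allpairsP[[k [e l]] [/= _ el ->]] /=.
  by have e1 := hEL1 _ _ el; split => //; apply/hEL.
have mF x : x \in s -> measurable (F x).
  move=> /sP[e1 [Tl _]]; apply: measurable_crossed => // i.
  exact/measurable_batch_factor/measurable_lratio.
have <- : size s = (m * size EL)%N by rewrite size_allpairs size_iota.
apply: (@expectation_ge _ _ _ _ _ (\big[setU/set0]_(x <- s) F x)) => //.
- by rewrite big_seq; apply: bigsetU_measurable => x; exact: mF.
- apply: probability_bigsetU_le => // x xs; have [e1 le] := sP _ xs.
  have [Tl _] := le.
  rewrite expRN -[leRHS]mule1 lee_pdivlMl ?expR_gt0//.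
  have gm := measurable_lratio e1 Tl.
  have g0 y := lratio_ge0 hp_ge0 htheta y e1 le.
  apply: ville => //.
  - by move=> i; exact: measurable_batch_factor.
  - by move=> i y; exact: batch_factor_ge0.
  - move=> i i0; apply: le_trans (integral_batch_factor_le (r := 1) hobs i0 _ gm g0 _) _.
    + exact: htheta.
    + rewrite -(hp_int Tl); apply: ge0_le_integral_nomeas => y.
        by rewrite lee_fin mulr_ge0// hp_ge0//; exact: htheta.
      rewrite lee_fin /lratio.
      (* Where the null density vanishes the left side is [0]; elsewhere it cancels and equality
         holds. Hence a mean of at most [1], not exactly [1]. *)
      have [->|pt0] := eqVneq (p (theta x.2.1) y) 0%R.
        by rewrite mulr0 hp_ge0.
      by rewrite divfK.
    + by case: ifP.
- by move=> w; exact: tau_o_ge0.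
move=> w Bw; apply: tau_o_ge => e n e1 nm.
rewrite lt_Wstat// => -[k [l [kn hl h]]]; apply: Bw.
rewrite -bigcup_seq; exists (k, (e, l)).
  apply/allpairsP; exists (k, (e, l)); split => //=; last exact/hEL.
  by rewrite mem_iota; lia.
by apply: crossedP h; lia.
Qed.


(** * Occurrences of a batch in successive periods *)

Hypothesis hNinc : forall j, (j < E)%N -> (N j < N j.+1)%N.
Hypothesis hNE : N E = per.
Hypothesis hper : (0 < per)%N.

(** The last position of batch [e] gives one explicit time of the batch in each period. The shift in
    [resid] gives it residue [N e] even when [N e = per]. *)
Lemma in_batch_last e m : (1 <= e <= E)%N ->
  in_batch per E N (per * m + N e) e /\ (0 < N e <= per)%N.
Proof.
case: e => // e /= eE.
have Nle a b : (a <= b)%N -> (b <= E)%N -> (N a <= N b)%N.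
  move=> ab; elim: b ab => [|b IH]; first by rewrite leqn0 => /eqP ->.
  rewrite leq_eqVlt => /orP[/eqP ->//|ab bE].
  by apply: leq_trans (IH _ _) (ltnW (hNinc bE)) => //; exact: ltnW.
have N0 : (0 < N e.+1)%N by apply: leq_ltn_trans (leq0n _) (hNinc eE).
have Nper : (N e.+1 <= per)%N by rewrite -hNE Nle.
split; last by rewrite N0.
rewrite /in_batch eE /= /resid.
have -> : ((per * m + N e.+1).-1 %% per).+1 = N e.+1.
  rewrite -(prednK N0) addnS /= mulnC modnMDl modn_small//.
  by rewrite prednK.
by rewrite leqnn andbT hNinc.
Qed.

(** One factor [r] is kept per period, at the last time of batch [e]; all others are at most [1]. *)
Lemma prod_batch_le e (r : R) m : (1 <= e <= E)%N -> (0 <= r <= 1)%R ->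
  (\prod_(1 <= i < (per * m).+1) (if in_batch per E N i e then r else 1) <=
   r ^+ m)%R.
Proof.
move=> he /andP[r0 r1].
have F0 i : (0 <= (if in_batch per E N i e then r else 1))%R by case: ifP.
have F1 i : ((if in_batch per E N i e then r else 1) <= 1)%R by case: ifP.
elim: m => [|m IH]; first by rewrite muln0 big_geq.
have [hi /andP[N0 Nper]] := in_batch_last m he.
rewrite (big_cat_nat (n := (per * m).+1))//=; last by rewrite ltnS leq_mul2l leqnSn orbT.
rewrite exprSr ler_pM// ?prodr_ge0//.
rewrite (big_cat_nat (n := (per * m + N e)%N))//=; last 2 first.
- by lia.
- by rewrite mulnS; lia.
have prod1 a b :
    (\prod_(a <= i < b) (if in_batch per E N i e then r else 1) <= 1)%R.
  by apply: prodr_ile1 => i _; rewrite F0 F1.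
rewrite -[leRHS]mul1r ler_pM// ?prodr_ge0//.
rewrite big_ltn ?hi; last by rewrite mulnS; lia.
by rewrite -[leRHS]mulr1 ler_pM// ?prodr_ge0.
Qed.

(** * Detection delay when batch [e] changes to [l] at time [1] *)

Section change.
Variables (e : nat) (l r : R).
Hypothesis he : (1 <= e <= E)%N.
Hypothesis hl : Lambda Theta theta eps e l.
Hypothesis r01 : (0 <= r <= 1)%R.
Hypothesis hr : \int[mu]_y (Num.sqrt (p l y * p (theta e) y))%:E <= r%:E.
Hypothesis hKL : KL_finite_pos mu p l (theta e).
Let par (k j : nat) := if (1 <= k)%N && (j == e) then l else theta j.
Hypothesis hobs : obs_model mu p per E N P Y par.

Let L j w := lprod Y (batch_factor per E N e (lratio p theta e l)) 0 j w.
Let Tl : Theta l := hl.1.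
Let Te : Theta (theta e) := htheta he.
Let mY := hobs.1.
Let indepY := hobs.2.1.
Let mratio : measurable_fun setT (lratio p theta e l) := measurable_lratio he Tl.
Let ratio0 y : (0 <= lratio p theta e l y)%R := lratio_ge0 hp_ge0 htheta y he hl.

Let parE i : (0 < i)%N -> par i e = l.
Proof. by move=> i0; rewrite /par i0 eqxx. Qed.

Let mL j : measurable_fun setT (L j).
Proof. by apply: measurable_lprod => // i; exact: measurable_batch_factor. Qed.

Let L0 j w : (0 <= L j w)%R.
Proof. by apply: lprod_ge0 => i y; exact: batch_factor_ge0. Qed.

Let mset (Q : R -> bool) (f : O -> R) : measurable_fun setT (fun w => Q (f w)) ->
  measurable [set w | Q (f w)].
Proof. by move=> /(_ measurableT [set true] Logic.I); rewrite setTI. Qed.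

(** Absolute continuity, part of [KL_finite_pos], keeps each ratio nonzero almost surely under
    [p l]. The event is treated apart because [0^-1 = 0]: the inverse square root is [0] there, and
    Markov's inequality does not detect it. *)
Lemma lprod_lratio_eq0_null j : P [set w | L j w == 0%R] = 0.
Proof.
have meq j' : measurable [set w | L j' w == 0%R].
  exact: (@mset (fun x => x == 0%R)) (measurable_fun_eqr _ _).
elim: j => [|j IH].
  rewrite (_ : [set w | _] = set0) ?measure0//.
  by apply/seteqP; split => // w /=; rewrite /L lprod0 oner_eq0.
pose B := [set y | batch_factor per E N e (lratio p theta e l) j.+1 y == 0%R].
have mB : measurable B.
  have /(_ measurableT [set true] Logic.I) := measurable_fun_eqr
    (@measurable_batch_factor e _ j.+1 mratio) (@measurable_cst _ _ T _ setT (0%R : R)).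
  by rewrite setTI.
have mYB : measurable (Y j.+1 @^-1` B).
  by rewrite -[X in measurable X]setTI; exact: mY.
have PB : P (Y j.+1 @^-1` B) = 0.
  have [hb|hb] := boolP (in_batch per E N j.+1 e); last first.
    rewrite (_ : B = set0) ?preimage_set0 ?measure0//.
    by apply/seteqP; split => // y; rewrite /B /= /batch_factor (negbTE hb) oner_eq0.
  rewrite (hobs.2.2 _ _ _ hb)// parE//.
  rewrite (ae_eq_integral (cst 0))//; first by rewrite integral0.
    by apply/measurable_EFinP; apply: measurable_funTS; exact: hp_meas.
  apply: filterS hKL.1 => y hy; rewrite /B /= /batch_factor hb.
  have := hp_ge0 y Tl; rewrite le_eqVlt => /predU1P[<-//|ply].
  by rewrite /lratio mulf_eq0 invr_eq0 !gt_eqF// hy.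
apply/eqP; rewrite eq_le measure_ge0 andbT.
apply: (@le_trans _ _ (P ([set w | L j w == 0%R] `|` Y j.+1 @^-1` B))).
  apply: le_measure; rewrite ?inE//; first exact: measurableU.
  by move=> w /=; rewrite /L lprodS mulf_eq0 => /orP[]; [left|right].
apply: (@le_trans _ _ (P [set w | L j w == 0%R] + P (Y j.+1 @^-1` B))).
  exact: measureU2.
by rewrite IH PB add0e.
Qed.

Let g y := Num.sqrt (p (theta e) y / p l y).

Let g0 y : (0 <= g y)%R. Proof. exact: sqrtr_ge0. Qed.

Let mg : measurable_fun setT g.
Proof.
apply: (measurableT_comp measurable_sqrt); apply: measurable_funM.
  exact: hp_meas.
by apply: measurable_funV_ge0; [exact: hp_meas|move=> y; exact: hp_ge0].
Qed.

(* When a likelihood ratio vanishes, both sides are [0] since [0^-1 = 0]. *)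
Let gL j w : lprod Y (batch_factor per E N e g) 0 j w = (Num.sqrt (L j w))^-1%R.
Proof.
elim: j => [|j IH]; first by rewrite /L !lprod0 sqrtr1 invr1.
rewrite /L !lprodS IH sqrtrM ?L0// invfM; congr (_ * _)%R.
rewrite /batch_factor; case: ifP => _; last by rewrite sqrtr1 invr1.
by rewrite /g -sqrtrV ?ratio0// /lratio invf_div.
Qed.

(** The factor [p l y] absorbs the denominator under the root, which leaves the integrand of the
    affinity; where [p l y = 0] both are [0]. *)
Lemma integral_sqrt_lratioV_le : \int[mu]_y (g y * p l y)%:E <= r%:E.
Proof.
apply: le_trans hr; rewrite le_eqVlt; apply/orP; left; apply/eqP.
apply: eq_integral => y _; congr EFin; rewrite /g.
have := hp_ge0 y Tl; rewrite le_eqVlt => /predU1P[<-|ply].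
  by rewrite mulr0 mul0r sqrtr0.
rewrite -{2}(ger0_norm (ltW ply)) -sqrtr_sqr -sqrtrM; last first.
  by rewrite divr_ge0// hp_ge0.
by congr Num.sqrt; field; rewrite gt_eqF.
Qed.

(** A Chernoff bound with exponent one half: off the null event where the product is [0], a product
    at most [c] makes [Num.sqrt c * G] at least [1], and [G] has mean at most [r ^+ m]. *)
Lemma prob_lprod_lratio_le (c : R) m : (0 < c)%R ->
  P [set w | (L (per * m) w <= c)%R] <= (Num.sqrt c * r ^+ m)%:E.
Proof.
move=> c0; set n := (per * m)%N.
pose G := lprod Y (batch_factor per E N e g) 0 n.
have mG : measurable_fun setT G.
  by apply: measurable_lprod => // i; exact: measurable_batch_factor.
have G0 w : (0 <= G w)%R by apply: lprod_ge0 => i y; exact: batch_factor_ge0.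
have EG : \int[P]_w (G w)%:E <= (r ^+ m)%:E.
  apply: (@le_trans _ _ (\prod_(1 <= i < (0 + n).+1)
      (if in_batch per E N i e then r else 1))%:E).
    apply: (integral_lprod_le mY indepY).
    - by move=> i; exact: measurable_batch_factor.
    - by move=> i y; exact: batch_factor_ge0.
    - by move=> i; case: ifP => // _; case/andP: r01.
    - move=> i i0; apply: (integral_batch_factor_le hobs i0) => //; rewrite parE//.
      exact: integral_sqrt_lratioV_le.
  by rewrite lee_fin add0n prod_batch_le.
have mZ : measurable [set w | L n w == 0%R].
  exact: (@mset (fun x => x == 0%R)) (measurable_fun_eqr _ _).
have mGc : measurable [set w | (1 <= Num.sqrt c * G w)%R].
  apply: (@mset (fun x => 1 <= x)%R); apply: measurable_fun_ler => //.
  exact: measurable_funM.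
apply: (@le_trans _ _ (P ([set w | L n w == 0%R] `|`
    [set w | (1 <= Num.sqrt c * G w)%R]))).
  apply: le_measure; rewrite ?inE//.
  - exact: (@mset (fun x => x <= c)%R) (measurable_fun_ler _ _).
  - exact: measurableU.
  - move=> w /= Lc; have := L0 n w; rewrite le_eqVlt => /predU1P[<-|Lw0].
      by left; rewrite eqxx.
    right; rewrite /G gL ler_pdivlMr ?sqrtr_gt0// mul1r.
    exact: ler_wsqrtr.
apply: (@le_trans _ _ (P [set w | L n w == 0%R] +
                       P [set w | (1 <= Num.sqrt c * G w)%R])).
  exact: measureU2.
rewrite lprod_lratio_eq0_null add0e.
rewrite -(setIT [set w | _]) -integral_indic//.
apply: (@le_trans _ _ (\int[P]_w ((Num.sqrt c)%:E * (G w)%:E))).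
  apply: ge0_le_integral_nomeas => w; first by rewrite lee_fin.
  rewrite indicE -EFinM lee_fin; case: (boolP (w \in _)) => [|_].
    by rewrite inE.
  by rewrite mulr_ge0// sqrtr_ge0.
rewrite ge0_integralZl//=; last 2 first.
- exact/measurable_EFinP.
- by move=> w _; rewrite lee_fin.
by rewrite EFinM lee_wpmul2l// lee_fin sqrtr_ge0.
Qed.

(** The first [n0] periods absorb the factor [Num.sqrt (expR A)], so the product is still below the
    threshold [j] periods later with probability at most [r ^+ j]. The periods beyond [n0] are
    counted by the series [S] of these indicators, whose mean is at most a geometric sum. *)
Lemma expectation_change_le (A : R) (n0 : nat) : (0 < n0)%N -> (r < 1)%R ->
  (Num.sqrt (expR A) * r ^+ n0 <= 1)%R ->
  \int[P]_w tau_o p per E N Theta theta eps A Y w <=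
    (per%:R * (n0%:R + (1 - r)^-1))%:E.
Proof.
move=> n00 r1 hn0; have r0 : (0 <= r)%R by case/andP: r01.
pose D j := [set w | (L (per * (n0 + j)) w <= expR A)%R].
have mD j : measurable (D j).
  exact: (@mset (fun x => x <= expR A)%R) (measurable_fun_ler _ _).
have PD j : P (D j) <= (r ^+ j)%:E.
  apply: le_trans (prob_lprod_lratio_le _ (expR_gt0 _)) _.
  by rewrite lee_fin exprD mulrA -[leRHS]mul1r ler_wpM2r// exprn_ge0.
pose S w : \bar R := \sum_(0 <= j <oo) (\1_(D j) w)%:E.
have ind0 j w : 0 <= (\1_(D j) w : R)%:E by rewrite lee_fin.
have S0 w : 0 <= S w by exact: nneseries_ge0.
have mS : measurable_fun setT S.
  apply: ge0_emeasurable_sum => // j _.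
  by apply/measurable_EFinP; exact: measurable_indic.
have SJ w J : (forall j, (j < J)%N -> D j w) -> J%:R%:E <= S w.
  move=> DJ; apply: le_trans (nneseries_lim_ge J _); last by [].
  rewrite sumEFin lee_fin big_nat (eq_bigr (fun=> 1%R)); last first.
    by move=> j jJ; rewrite indicE mem_set//; exact: DJ.
  by rewrite -big_nat sumr_const_nat subn0.
have tauS w : tau_o p per E N Theta theta eps A Y w <=
    per%:R%:E * (n0%:R%:E + S w).
  (* Either every [D j] holds and the bound is [+oo], or the least [j] for which [D j] fails is at
     most [S w], and the statistic has crossed by time [per * (n0 + j)]. *)
  have [[j nDj]|allD] := pselect (exists j, ~~ `[< D j w >]); last first.
    have -> : S w = +oo.
      apply/eqyP => x x0; apply: (@le_trans _ _ (Num.truncn x).+1%:R%:E).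
        by rewrite lee_fin ltW// truncnS_gt.
      apply: SJ => j _; apply: contrapT => nD; apply: allD; exists j.
      by apply/asboolPn.
    by rewrite addey// gt0_muley ?leey// lte_fin ltr0n.
  have exj : exists j, ~~ `[< D j w >] by exists j.
  case: (ex_minnP exj) => {nDj}j /asboolPn nDj jmin.
  have jS : j%:R%:E <= S w.
    apply: SJ => i ij; apply: contrapT => nD.
    have := jmin i; rewrite leqNgt ij => /(_ _)/negP; apply => //.
    exact/asboolPn.
  apply: (@le_trans _ _ (per * (n0 + j))%:R%:E); last first.
    by rewrite natrM natrD EFinM EFinD lee_wpmul2l// ?lee_fin ?ler0n// leeD2l.
  have n1 : (0 < per * (n0 + j))%N by rewrite muln_gt0 hper addn_gt0 n00.
  apply: (tau_o_le he n1); rewrite lt_Wstat//.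
  (* The statistic maximises over start times and parameters, so starting at the first observation
     with the true [l] suffices. *)
  exists 0%N, l; split => //; rewrite subn0 -/(L _ _) ltNge.
  exact/negP.
apply: (@le_trans _ _ (\int[P]_w (per%:R%:E * (n0%:R%:E + S w)))).
  by apply: ge0_le_integral_nomeas => // w; exact: tau_o_ge0.
have mnS : measurable_fun setT (fun w => n0%:R%:E + S w) by exact: emeasurable_funD.
have nS0 w : 0 <= n0%:R%:E + S w by rewrite adde_ge0// lee_fin.
rewrite ge0_integralZl// EFinM lee_wpmul2l ?lee_fin// ge0_integralD//.
rewrite integral_cst//= probability_setT mule1 EFinD leeD2l//.
rewrite integral_nneseries//; last first.
  by move=> j; apply/measurable_EFinP; exact: measurable_indic.
apply: lime_le; first by apply: is_cvg_nneseries => j _ _; exact: integral_ge0.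
apply: nearW => J.
apply: (@le_trans _ _ (\sum_(0 <= j < J) (r ^+ j)%:E)).
  by apply: lee_sum => j _; rewrite integral_indic// setIT; exact: PD.
rewrite sumEFin lee_fin -[leRHS]mul1r ler_pdivlMr ?subr_gt0//.
suff -> : ((\sum_(0 <= j < J) r ^+ j) * (1 - r) = 1 - r ^+ J)%R.
  by rewrite gerBl exprn_ge0.
elim: J => [|J IH]; first by rewrite big_geq// mul0r expr0 subrr.
by rewrite big_nat_recr//= mulrDl IH exprS; ring.
Qed.

End change.

End bounds.

(** * Logarithmic asymptotics and uniform constants *)

Section asymptotics.
Context {R : realType}.

Lemma near_pinfty_ln (M : R) : \forall b \near +oo%R, M < ln b.
Proof.
near=> b; have Mb : expR M < b by near: b; exact: nbhs_pinfty_gt.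
by rewrite -ltr_expR lnK// posrE (lt_trans (expR_gt0 M)).
Unshelve. all: by end_near. Qed.

Lemma cvg_lnM_div_ln (a : R) : 0 < a ->
  (ln (a * b) / ln b) @[b --> +oo%R] --> (1 : R).
Proof.
move=> a0; apply/cvgrPdist_lt => d d0; near=> b.
have b0 : 0 < b by near: b; exact: nbhs_pinfty_gt.
have lb0 : 0 < ln b by near: b; exact: near_pinfty_ln.
have lb : `|ln a| / d < ln b by near: b; exact: near_pinfty_ln.
rewrite lnM// mulrDl divff ?gt_eqF// opprD addrC subrK normrN normrM.
rewrite (gtr0_norm (x := (ln b)^-1)) ?invr_gt0//.
by rewrite ltr_pdivrMr// mulrC -ltr_pdivrMr.
Unshelve. all: by end_near. Qed.

(** A maximum over a finite list stays below [1]. Starting from [2^-1] also keeps [r] positive, so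
    that [ln r] is meaningful later. *)
Lemma uniform_lt1 (I : eqType) (s : seq I) (F : I -> \bar R) :
  (forall i, i \in s -> 0 <= F i < 1)%E ->
  exists r : R, [/\ 0 < r, r < 1 & forall i, i \in s -> (F i <= r%:E)%E].
Proof.
elim: s => [_|i s IH H]; first by exists 2^-1; split => //; lra.
have [j js|r [r0 r1 Hr]] := IH; first by apply: H; rewrite inE js orbT.
have /andP[Fi0 Fi1] : (0 <= F i < 1)%E by apply: H; rewrite inE eqxx.
have Ffin : F i \is a fin_num by rewrite ge0_fin_numE// (lt_trans Fi1)// ltry.
exists (Num.max r (fine (F i))); split.
- by rewrite lt_max r0.
- by rewrite gt_max r1 -lte_fin fineK.
- move=> j; rewrite inE => /orP[/eqP ->|js].
    by rewrite -(fineK Ffin) lee_fin /= le_max lexx orbT.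
  by apply: le_trans (Hr _ js) _; rewrite lee_fin le_max lexx.
Qed.

(** The left side is the exponential of [A / 2 + n * ln r], which the hypothesis makes
    nonpositive. *)
Lemma sqrt_expRM_le1 (A r : R) (n : nat) : 0 < r -> A <= n%:R * (- (2 * ln r)) ->
  Num.sqrt (expR A) * r ^+ n <= 1.
Proof.
move=> r0 hA.
have -> : Num.sqrt (expR A) = expR (A / 2).
  rewrite -[RHS]ger0_norm ?expR_ge0// -sqrtr_sqr -expRM_natl.
  by congr (Num.sqrt (expR _)); field.
by rewrite -{1}(lnK r0) -expRM_natl -expRD expR_le1; lra.
Qed.

End asymptotics.

(** * Choice of the constants and assembly of the two bounds *)

Theorem theorem1 (R : realType) (dT : measure_display) (T : measurableType dT)
  (mu : {measure set T -> \bar R}) (Theta : set R) (p : R -> T -> R)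
  (hp_meas : forall t, Theta t -> measurable_fun setT (p t))
  (hp_ge0 : forall t y, Theta t -> 0 <= p t y)
  (hp_int : forall t, Theta t -> (\int[mu]_y (p t y)%:E = 1)%E)
  (hKL : forall t t', Theta t -> Theta t' -> t <> t' -> KL_finite_pos mu p t t')
  (per E : nat) (N : nat -> nat)
  (hper : (0 < per)%N) (hN0 : N 0%N = 0%N)
  (hNinc : forall j, (j < E)%N -> (N j < N j.+1)%N) (hNE : N E = per)
  (theta : nat -> R) (htheta : forall e, (1 <= e <= E)%N -> Theta (theta e))
  (eps : R) (heps : 0 < eps)
  (hfin : forall e, (1 <= e <= E)%N -> finite_set (Lambda Theta theta eps e)) :
  exists A : R -> R,
    (A b / ln b) @[b --> +oo%R] --> (1 : R) /\
    (forall (dO : measure_display) (O : measurableType dO)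
            (P : probability O R) (Y : nat -> O -> T),
       obs_model mu p per E N P Y (fun k j => theta j) ->
       forall delta, 0 < delta ->
         \forall b \near +oo%R,
           (((1 - delta) * b)%:E <=
            \int[P]_w tau_o p per E N Theta theta eps (A b) Y w)%E) /\
    exists C : R, 0 < C /\
      forall (e : nat) (l : R), (1 <= e <= E)%N -> Lambda Theta theta eps e l ->
      forall (dO : measure_display) (O : measurableType dO)
             (P : probability O R) (Y : nat -> O -> T),
        obs_model mu p per E N P Y
          (fun k j => if (1 <= k)%N && (j == e) then l else theta j) ->
        forall delta, 0 < delta ->
          \forall b \near +oo%R,
            (\int[P]_w tau_o p per E N Theta theta eps (A b) Y w <=
             (C * (1 + delta) * ln b)%:E)%E.
Proof.
(* All admissible pairs go in one list: its length enters the union bound, and its finiteness gives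
   one affinity bound [r] for all of them. *)
have [EL [EL1 ELP]] : exists EL : seq (nat * R),
    (forall e l, (e, l) \in EL -> (1 <= e <= E)%N) /\
    (forall e l, (1 <= e <= E)%N ->
       Lambda Theta theta eps e l <-> (e, l) \in EL).
  have /choice[s hs] : forall e, exists s : seq R,
      (1 <= e <= E)%N -> Lambda Theta theta eps e = [set` s].
    move=> e; case: (boolP (1 <= e <= E)%N) => he; last by exists [::].
    by have /finite_seqP[s ->] := hfin e he; exists s.
  exists [seq (e, l) | e <- iota 1 E, l <- s e]; split=> [e l|e l he].
    by move=> /allpairsPdep[e' [l' [+ _ [-> _]]]]; rewrite mem_iota; lia.
  rewrite hs//; split=> [ls|/allpairsPdep[e' [l' [_ + [-> ->]]]]//].
  by apply/allpairsPdep; exists e, l; split => //; rewrite mem_iota; lia.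
pose K : R := (size EL)%:R.
have K0 : 0 <= K by exact: ler0n.
(* The threshold has [expR (- A) = (a * b)^-1]. With [m <= 3 * b] the exceptional probability is at
   most [3 / 8], so the mean is at least [2 * b * (5 / 8)], which exceeds [b]. *)
pose a : R := 8 * (K + 1).
have a0 : 0 < a by rewrite /a; lra.
exists (fun b => ln (a * b)); split; first exact: cvg_lnM_div_ln.
split=> [dO O P Y hobs delta delta0|].
  near=> b.
  have b1 : 1 < b by near: b; exact: nbhs_pinfty_gt.
  have b0 : 0 < b by lra.
  have ab0 : 0 < a * b by exact: mulr_gt0.
  pose m := (Num.truncn (2 * b)).+1.
  have m2 : 2 * b < m%:R by exact: truncnS_gt.
  have m3 : m%:R <= 3 * b.
    have : (Num.truncn (2 * b))%:R <= 2 * b by rewrite truncn_le; lra.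
    by rewrite /m -natr1; lra.
  have := @expectation_null_ge _ _ _ mu Theta p hp_meas hp_ge0 hp_int per E N
    theta eps htheta _ _ P Y EL (ln (a * b)) m ELP EL1 hobs.
  apply: le_trans; rewrite lee_fin expRN (lnK ab0) natrM -/K.
  have mKa : m%:R * K / (a * b) <= 3 / 8.
    rewrite ler_pdivrMr//; apply: (@le_trans _ _ (3 * b * K)).
      exact: ler_wpM2r.
    by rewrite /a; nra.
  nra.
have [r [r0 r1 hr]] : exists r : R, [/\ 0 < r, r < 1 & forall i, i \in EL ->
    (\int[mu]_y (Num.sqrt (p i.2 y * p (theta i.1) y))%:E <= r%:E)%E].
  apply: uniform_lt1 => -[e l] el /=; have e1 := EL1 _ _ el.
  have [Tl leps] : Lambda Theta theta eps e l by exact/ELP.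
  have Te := htheta e e1; apply/andP; split.
    by apply: integral_ge0 => y _; rewrite lee_fin sqrtr_ge0.
  apply: hellinger_lt1; rewrite ?hp_int//; [exact: hp_meas..| | |].
  - by move=> y; exact: hp_ge0.
  - by move=> y; exact: hp_ge0.
  - by apply: hKL => // lt; move: leps; rewrite lt subrr normr0 leNgt heps.
(* A factor [r] lowers the exponent by [k / 2], against a threshold exponent [A / 2], so about
   [A / k] periods suffice. *)
pose k : R := - (2 * ln r).
have k0 : 0 < k by have := ln_lt0 (x := r); rewrite r0 r1 /k => /(_ isT); lra.
have per0 : 0 < per%:R :> R by rewrite ltr0n.
(* The leading constant is [per%:R / k]; the factor [2] leaves room for [ln a], the rounding in [n0]
   and the geometric sum. It is the same for all pairs, as [r] is. *)
exists (2 * per%:R / k); split; first by rewrite divr_gt0// mulr_gt0.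
move=> e l he hl dO O P Y hobs delta delta0; near=> b.
have b0 : 1 < b by near: b; exact: nbhs_pinfty_gt.
set A := ln (a * b).
have AE : A = ln a + ln b by rewrite /A lnM// posrE; lra.
have A0 : 0 <= A by rewrite ln_ge0// /a; nra.
pose n0 := (Num.truncn (A / k)).+1.
have n0A : A / k < n0%:R by exact: truncnS_gt.
have n0A' : n0%:R <= A / k + 1.
  by rewrite /n0 -natr1 lerD2r truncn_le divr_ge0// ltW.
have el : (e, l) \in EL by exact/ELP.
have [Tl leps] := hl.
have KLl : KL_finite_pos mu p l (theta e).
  apply: hKL => //; first exact: htheta.
  by move=> lt; move: leps; rewrite lt subrr normr0 leNgt heps.
have r01 : 0 <= r <= 1 by rewrite !ltW.
have := @expectation_change_le _ _ _ mu Theta p hp_meas hp_ge0 per E N theta eps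
  htheta _ _ P Y hNinc hNE hper e l r he hl r01 (hr _ el) KLl hobs A n0 isT r1.
move=> H; apply: le_trans (H _) _.
  by apply: sqrt_expRM_le1 => //; rewrite -ler_pdivrMr// -/k ltW.
rewrite lee_fin.
(* Since [A = ln a + ln b], this makes [A / k + 1 + (1 - r)^-1] at most [2 * ln b / k]. *)
have lb : ln a + k * (1 + (1 - r)^-1) < ln b.
  by near: b; exact: near_pinfty_ln.
have lb0 : 0 < ln b by near: b; exact: near_pinfty_ln.
apply: (@le_trans _ _ (per%:R * (2 * ln b / k))).
  apply: ler_wpM2l; first exact: ltW.
  apply: (@le_trans _ _ (A / k + 1 + (1 - r)^-1)); first by rewrite lerD2r.
  rewrite ler_pdivlMr// -addrA mulrDl divfK ?gt_eqF// AE mulrC.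
  by rewrite addrAC mulr_natl mulr2n lerD2r ltW.
rewrite (_ : 2 * per%:R / k * (1 + delta) * ln b =
  per%:R * (2 * ln b / k) * (1 + delta)); last by field; rewrite gt_eqF.
apply: ler_peMr; last by rewrite lerDl ltW.
by rewrite mulr_ge0 ?divr_ge0 ?mulr_ge0 ?ler0n// ltW.
Unshelve. all: by end_near. Qed.
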